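(* A generalized Maiorana--McFarland bent function \[ f(x,y)=\frac{q}{2}\langle x,\pi(y)\rangle+g(y),\quad x,y\in\mathbb{F}_2^{n/2}, \] is self-dual (respectively anti-self-dual) bent if and only if for any $y\in\mathbb{F}_2^{n/2}$ \[ \pi(y)=L(y\oplus b),\qquad g(y)=\frac{q}{2}\langle b,y\rangle+d, \] where $L\in\mathcal{O}_{n/2}$, $b\in\mathbb{F}_2^{n/2}$, $\mathrm{wt}(b)$ is even (respectively odd), and $d\in\mathbb{Z}_q$.
   Context: Let $q\geqslant 2$ be an even positive integer, $n$ an even positive integer, and $\omega=e^{2\pi i/q}$. For $x,y\in\mathbb{F}_2^m$, $\langle x,y\rangle=\bigoplus_{i=1}^m x_iy_i$, and $\mathrm{wt}(b)$ denotes the Hamming weight (number of nonzero coordinates) of $b$. $\mathcal{O}_m=\{L\in\mathrm{GL}(m,\mathbb{F}_2): LL^{T}=I_m\}$ is the orthogonal group of index $m$ over $\mathbb{F}_2$. A generalized Boolean function is a map $f:\mathbb{F}_2^n\to\mathbb{Z}_q$; its generalized Walsh--Hadamard transform is $H_f(y)=\sum_{x\in\mathbb{F}_2^n}\omega^{f(x)}(-1)^{\langle x,y\rangle}$. $f$ is generalized bent (gbent) if $|H_f(y)|=2^{n/2}$ for all $y$; it is regular if there is $\widetilde f:\mathbb{F}_2^n\to\mathbb{Z}_q$ (its dual) with $H_f(y)=2^{n/2}\omega^{\widetilde f(y)}$ for all $y$. A regular gbent $f$ is self-dual if $f=\widetilde f$ and anti-self-dual if $f=\widetilde f+q/2$.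 A generalized Maiorana--McFarland function is $f(x,y)=\frac{q}{2}\langle x,\pi(y)\rangle+g(y)$, $x,y\in\mathbb{F}_2^{n/2}$, with $\pi$ a permutation of $\mathbb{F}_2^{n/2}$ and $g:\mathbb{F}_2^{n/2}\to\mathbb{Z}_q$; it is gbent with dual $\widetilde f(x,y)=\frac{q}{2}\langle \pi^{-1}(x),y\rangle+g(\pi^{-1}(x))$. *)

(* Defs.v *)
From mathcomp Require Import all_boot all_order all_fingroup all_algebra.
From mathcomp Require Import complex.
From mathcomp Require Import reals trigo.
Set Implicit Arguments.
Unset Strict Implicit.
Unset Printing Implicit Defensive.
Import Order.TTheory GRing.Theory Num.Theory.
Local Open Scope ring_scope.
Local Open Scope complex_scope.

(* Vectors of F_2^m are column vectors, so that a matrix L acts by L *m x.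
   'Z_q is the ring of integers mod q only when 1 < q. *)

Definition dotF2 m (x y : 'cV['F_2]_m) : 'F_2 := \sum_i x i 0 * y i 0.

Definition wt m (b : 'cV['F_2]_m) : nat := #|[set i | b i 0 != 0]|.

Definition orthogonal_group m : {set 'M['F_2]_m} :=
  [set L | (L \in unitmx) && (L *m L^T == 1%:M)].

(* e ^ (2 pi i / q) *)
Definition omega (R : realType) (q : nat) : R[i] :=
  let t : R := 2 * pi / q%:R in cos t +i* sin t.

(* The exponents in 'Z_q and 'F_2 are read as their representatives in nat;
   this is harmless since omega ^+ q = 1 and (-1) ^+ 2 = 1. *)
Definition gWHT (R : realType) (q n : nat) (f : 'cV['F_2]_n -> 'Z_q)
    (y : 'cV['F_2]_n) : R[i] :=
  \sum_(x : 'cV['F_2]_n) omega R q ^+ f x * (-1) ^+ dotF2 x y.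

(* In this and the following definitions n is meant to be even, so that
   2 ^+ n./2 is 2 ^ (n / 2). *)
Definition gbent (R : realType) (q n : nat) (f : 'cV['F_2]_n -> 'Z_q) : Prop :=
  forall y, `|gWHT R f y| = 2 ^+ n./2.

Definition is_dual (R : realType) (q n : nat)
    (f ft : 'cV['F_2]_n -> 'Z_q) : Prop :=
  forall y, gWHT R f y = 2 ^+ n./2 * omega R q ^+ ft y.

(* The dual of a regular gbent function is unique when 1 < q. *)
Definition self_dual_gbent (R : realType) (q n : nat)
    (f : 'cV['F_2]_n -> 'Z_q) : Prop :=
  gbent R f /\ exists ft, is_dual R f ft /\ forall z, f z = ft z.

Definition anti_self_dual_gbent (R : realType) (q n : nat)
    (f : 'cV['F_2]_n -> 'Z_q) : Prop :=
  gbent R f /\ exists ft, is_dual R f ft /\ forall z, f z = ft z + (q./2)%:R.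

(* (q / 2) c in Z_q, for a bit c *)
Definition half_scale (q : nat) (c : 'F_2) : 'Z_q := (q./2 * c)%N%:R.

(* A vector of F_2^(2m) is the pair (x, y) of its upper and lower halves. *)
Definition gMM (q m : nat) (p : {perm 'cV['F_2]_m}) (g : 'cV['F_2]_m -> 'Z_q)
    (z : 'cV['F_2]_(m + m)) : 'Z_q :=
  let x := usubmx z in let y := dsubmx z in
  half_scale q (dotF2 x (p y)) + g y.

(* Main.v *)
(* Summing over x first, the transform of f at (x, y) only sees the y' with
   p y' = x, so the dual of f is (q/2)<p^-1 x, y> + g (p^-1 x).  Write h for
   c |-> (q/2) c, and let c be 0 (self-dual) or 1 (anti-self-dual).  Since omega
   is a primitive q-th root of unity, (anti-)self-duality is the identity
     h <x, p y> + g y = h <p^-1 x, y> + g (p^-1 x) + h c.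
   With b = p^-1 0, taking x = 0 gives g y = h <b, y> + d, and then y = b gives
   <b, b> = c, that is, the parity of wt b.  The identity becomes
     <x, p y + p 0> = <p^-1 x + b, y>,
   so y |-> p y + p 0 has an adjoint, hence is a matrix L with p^-1 x = L^T x + b;
   L L^T = 1 expresses that p and p^-1 are inverse to each other. *)
Require Import Defs.
From mathcomp Require Import all_boot all_order all_fingroup all_algebra.
From mathcomp Require Import complex.
From mathcomp Require Import reals trigo.
From mathcomp Require Import ring lra.
Set Implicit Arguments.
Unset Strict Implicit.
Import Order.TTheory GRing.Theory Num.Theory.
Local Open Scope ring_scope.

(** * Arithmetic of ['F_2] and its dot product *)

Lemma F2P (c : 'F_2) : (c = 0) + (c = 1).
Proof. by case: c => [[|[|//]] i]; [left | right]; apply: val_inj. Qed.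

Lemma addF2K m n (x : 'M['F_2]_(m, n)) : x + x = 0.
Proof.
by apply/matrixP => i j; rewrite !mxE; case: (F2P (x i j)) => ->; apply: val_inj.
Qed.

Lemma oppF2 m n (x : 'M['F_2]_(m, n)) : - x = x.
Proof. by apply/eqP; rewrite eq_sym -addr_eq0 addF2K. Qed.

Lemma addF2_eq0 (a b : 'F_2) : (a + b == 0) = (a == b).
Proof. by case: (F2P a) => ->; case: (F2P b) => ->. Qed.

Lemma signF2D (A : pzRingType) (a b : 'F_2) :
  (-1) ^+ (a + b)%R = (-1) ^+ a * (-1) ^+ b :> A.
Proof.
by case: (F2P a) => ->; case: (F2P b) => ->;
  rewrite /= ?expr0 ?expr1 ?mul1r ?mulr1 ?mulrNN ?mulr1.
Qed.

Lemma dotF2E m (x y : 'cV['F_2]_m) : dotF2 x y = (x^T *m y) 0 0.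
Proof. by rewrite mxE; apply: eq_bigr => i _; rewrite mxE. Qed.

Lemma dotF2C m (x y : 'cV['F_2]_m) : dotF2 x y = dotF2 y x.
Proof. by apply: eq_bigr => i _; rewrite mulrC. Qed.

Lemma dotF2Dr m (x y z : 'cV['F_2]_m) : dotF2 x (y + z) = dotF2 x y + dotF2 x z.
Proof. by rewrite !dotF2E mulmxDr mxE. Qed.

Lemma dotF2Dl m (x y z : 'cV['F_2]_m) : dotF2 (x + y) z = dotF2 x z + dotF2 y z.
Proof. by rewrite !dotF2E linearD mulmxDl mxE. Qed.

Lemma dotF2_0r m (x : 'cV['F_2]_m) : dotF2 x 0 = 0.
Proof. by rewrite dotF2E mulmx0 mxE. Qed.

Lemma dotF2_0l m (x : 'cV['F_2]_m) : dotF2 0 x = 0.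
Proof. by rewrite dotF2C dotF2_0r. Qed.

Lemma dotF2_mulmx m (A : 'M['F_2]_m) (x y : 'cV['F_2]_m) :
  dotF2 x (A *m y) = dotF2 (A^T *m x) y.
Proof. by rewrite !dotF2E trmx_mul trmxK mulmxA. Qed.

Lemma dotF2_delta m (i : 'I_m) (y : 'cV['F_2]_m) : dotF2 (delta_mx i 0) y = y i 0.
Proof. by rewrite dotF2E trmx_delta -rowE mxE. Qed.

Lemma dotF2_col_mx m n (x1 y1 : 'cV['F_2]_m) (x2 y2 : 'cV['F_2]_n) :
  dotF2 (col_mx x1 x2) (col_mx y1 y2) = dotF2 x1 y1 + dotF2 x2 y2.
Proof. by rewrite !dotF2E tr_col_mx mul_row_col mxE. Qed.

(** The square of a bit is 1 exactly on the support of [b]. *)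
Lemma dotF2_self m (b : 'cV['F_2]_m) : dotF2 b b = (wt b)%:R.
Proof.
rewrite /wt cardsE -sum1_card natr_sum [RHS]big_mkcond /=.
by apply: eq_bigr => i _; rewrite unfold_in; case: (F2P (b i 0)) => ->; apply: val_inj.
Qed.

Lemma odd_wt m (b : 'cV['F_2]_m) : odd (wt b) = (dotF2 b b == 1).
Proof.
rewrite dotF2_self -val_eqE /= val_Fp_nat // modn2.
by case: (odd _).
Qed.

(* Bilinearity of the dot product makes a map with an adjoint linear. *)
Lemma adjoint_linear m (A B : 'cV['F_2]_m -> 'cV['F_2]_m) :
    (forall x y, dotF2 x (A y) = dotF2 (B x) y) ->
  {L : 'M['F_2]_m | A =1 mulmx L & B =1 mulmx L^T}.
Proof.
(* Row [i] of [L] is forced: with e_i the unit vector, coordinate [i] of A y is <e_i, A y> = <B e_i,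
   y>. *)
move=> adjAB; exists (\matrix_(i, j) B (delta_mx i 0) j 0) => [y|x].
  apply/colP => i; rewrite -dotF2_delta adjAB mxE.
  by apply: eq_bigr => j _; rewrite mxE.
apply/colP => j; rewrite -dotF2_delta dotF2C -adjAB mxE.
apply: eq_bigr => i _; rewrite -[A _ _ _]dotF2_delta adjAB !mxE dotF2C dotF2_delta.
by rewrite mulrC.
Qed.

(** Orthogonality of characters: if u_i = 1, translating x by the unit vector e_i flips every sign,
    so the sum equals its own opposite. *)
Lemma sum_sign_dotF2 (A : numDomainType) m (u : 'cV['F_2]_m) :
  \sum_x (-1) ^+ dotF2 x u = (if u == 0 then 2 ^+ m else 0) :> A.
Proof.
have [->|u_neq0] := eqVneq.
  under eq_bigr do rewrite dotF2_0r expr0.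
  by rewrite sumr_const card_mx card_Fp // muln1 natrX.
have [i ui] : exists i, u i 0 = 1.
  case/cV0Pn: u_neq0 => i ui; exists i.
  by case: (F2P (u i 0)) ui => ->.
set s := \sum_x _; suff: s = - s by move/eqP; rewrite -addr_eq0 -mulr2n mulrn_eq0 => /eqP.
rewrite {1}/s (reindex_inj (addrI (delta_mx i 0))) /= -sumrN.
by apply: eq_bigr => x _; rewrite dotF2Dl dotF2_delta ui signF2D mulN1r.
Qed.

(** * Primitivity of the root of unity [omega] *)

Section Omega.
Variables (R : realType) (q : nat).
Hypotheses (q_ge2 : (2 <= q)%N) (q_even : ~~ odd q).
Local Notation w := (omega R q).
Local Notation h := (half_scale q).

Lemma omegaX n :
  w ^+ n = (cos (2 * pi / q%:R * n%:R) +i* sin (2 * pi / q%:R * n%:R))%C.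
Proof.
elim: n => [|n IH]; first by rewrite mulr0 cos0 sin0.
rewrite exprS IH /omega; set t := 2 * pi / q%:R.
by rewrite -natr1 mulrDr mulr1 addrC cosD sinD [_ + cos t * _]addrC.
Qed.

Lemma omega_half : w ^+ q./2 = -1.
Proof.
rewrite omegaX.
have -> : 2 * pi / q%:R * (q./2)%:R = pi :> R.
  rewrite -[X in X%:R^-1](even_halfK q_even) -muln2 natrM; field.
  by rewrite pnatr_eq0 -lt0n half_gt0.
by rewrite cospi sinpi; apply/eqP; rewrite eq_complex /= oppr0 !eqxx.
Qed.

Lemma omega_exp : w ^+ q = 1.
Proof. by rewrite -[X in _ ^+ X](even_halfK q_even) -muln2 exprM omega_half sqrrN expr1n. Qed.

(** If n > 0, then t = pi n / q lies strictly between 0 and pi, so sin t > 0, whereas cos 2t = 1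
    forces sin t = 0. *)
Lemma omegaX_eq1 n : (n < q)%N -> w ^+ n = 1 -> n = 0%N.
Proof.
move=> n_lt; rewrite omegaX => -[cos1 _]; apply/eqP; rewrite -leqn0 leqNgt.
apply/negP => n_gt0; set t := pi * (n%:R / q%:R) : R.
have q0 : 0 < q%:R :> R by rewrite ltr0n (ltn_trans n_gt0).
have t_pi : 0 < t < pi.
  rewrite mulr_gt0 ?divr_gt0 ?pi_gt0 ?(ltr0n R n) //=.
  by rewrite -[ltRHS]mulr1 ltr_pM2l ?pi_gt0 // ltr_pdivrMr // mul1r ltr_nat.
have := sin_gt0_pi t_pi; have := cos2Dsin2 t.
move: cos1; have -> : 2 * pi / q%:R * n%:R = t *+ 2 by rewrite /t mulr2n; ring.
by rewrite cos_mulr2n; nra.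
Qed.

(** For representatives a <= b below q, cancelling omega^a leaves omega^(b - a) = 1 with b - a <
    q. *)
Lemma omega_inj : injective (fun a : 'Z_q => w ^+ a).
Proof.
have w_neq0 : w != 0.
  apply/eqP => w0; have /eqP := omega_exp.
  by rewrite w0 expr0n (gtn_eqF (ltnW q_ge2)) eq_sym oner_eq0.
suff le_inj (a b : 'Z_q) : (a <= b)%N -> w ^+ a = w ^+ b -> a = b.
  move=> a b /= eqw; case/orP: (leq_total a b) => [/le_inj|/le_inj] ; auto.
  by move/(_ (esym eqw)).
move=> le_ab /eqP; rewrite -(subnKC le_ab) exprD -subr_eq0 -{1}[_ ^+ a]mulr1 -mulrBr.
rewrite mulf_eq0 expf_eq0 (negPf w_neq0) andbF /= subr_eq0 eq_sym => /eqP/omegaX_eq1.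
have b_lt : (b < q)%N by case: (b : 'Z_q) => k /=; rewrite Zp_cast.
move=> /(_ (leq_ltn_trans (leq_subr _ _) b_lt)) /eqP; rewrite subn_eq0 => le_ba.
by apply: val_inj; apply/eqP; rewrite eqn_leq le_ab.
Qed.

Lemma omega_natr n : w ^+ (n%:R : 'Z_q)%R = w ^+ n.
Proof. by rewrite val_Zp_nat // expr_mod // omega_exp. Qed.

Lemma omegaD (a b : 'Z_q) : w ^+ (a + b)%R = w ^+ a * w ^+ b.
Proof. by rewrite -exprD -[RHS]omega_natr natrD !natr_Zp. Qed.

Lemma omega_half_scale (c : 'F_2) : w ^+ h c = (-1) ^+ c.
Proof. by rewrite omega_natr exprM omega_half. Qed.

Lemma omega_norm : `|w| = 1.
Proof. by rewrite normc_def /= cos2Dsin2 sqrtr1. Qed.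

End Omega.

(** * The embedding of ['F_2] into ['Z_q] by multiplication by q/2 *)

Section HalfScale.
Variables (q : nat).
Hypotheses (q_ge2 : (2 <= q)%N) (q_even : ~~ odd q).

Lemma half_scale0 : half_scale q 0 = 0.
Proof. by rewrite /half_scale muln0. Qed.

Lemma half_scale1 : half_scale q 1 = (q./2)%:R.
Proof. by rewrite /half_scale muln1. Qed.

(** The only carry, 1 + 1, is harmless because q/2 + q/2 = q vanishes in ['Z_q]. *)
Lemma half_scaleD (a b : 'F_2) :
  half_scale q (a + b) = half_scale q a + half_scale q b.
Proof.
case: (F2P a) => ->; first by rewrite half_scale0 !add0r.
case: (F2P b) => ->; first by rewrite half_scale0 !addr0.
have -> : 1 + 1 = 0 :> 'F_2 by apply: val_inj.
by rewrite half_scale0 half_scale1 -natrD addnn even_halfK // pchar_Zp.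
Qed.

Lemma half_scale_inj : injective (half_scale q).
Proof.
have h1 : half_scale q 1 != 0.
  rewrite half_scale1 -val_eqE /= val_Zp_nat // modn_small ?half_gt0.
    by rewrite -lt0n half_gt0.
  by rewrite ltn_half_double -muln2 ltn_Pmulr // ltnW.
move=> a b; case: (F2P a) => ->; case: (F2P b) => -> //;
  rewrite half_scale0 => /eqP; by rewrite ?(negPf h1) // eq_sym (negPf h1).
Qed.

End HalfScale.

(** * Maiorana--McFarland functions and their duals *)

Definition gMM_dual (q m : nat) (p : {perm 'cV['F_2]_m}) (g : 'cV['F_2]_m -> 'Z_q)
    (z : 'cV['F_2]_(m + m)) : 'Z_q :=
  half_scale q (dotF2 (p^-1%g (usubmx z)) (dsubmx z)) + g (p^-1%g (usubmx z)).

Section MM.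
Variables (R : realType) (q m : nat).
Hypotheses (q_ge2 : (2 <= q)%N) (q_even : ~~ odd q).
Variables (p : {perm 'cV['F_2]_m}) (g : 'cV['F_2]_m -> 'Z_q).

Lemma is_dual_gMM : is_dual R (gMM p g) (gMM_dual p g).
Proof.
move=> z; rewrite -[z]vsubmxK; set a := usubmx z; set b := dsubmx z.
rewrite /gWHT (reindex (fun u => col_mx u.1 u.2)); last first.
  exists (fun x => (usubmx x, dsubmx x)) => [[x y] _|x _] /=.
    by rewrite col_mxKu col_mxKd.
  by rewrite vsubmxK.
rewrite -(pair_bigA _ (fun x y => omega R q ^+ gMM p g (col_mx x y) *
   (-1) ^+ dotF2 (col_mx x y) (col_mx a b))) exchange_big /=.
transitivity (\sum_y omega R q ^+ g y * (-1) ^+ dotF2 y b *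
    \sum_x (-1) ^+ dotF2 x (p y + a) : R[i]).
  apply: eq_bigr => y _; rewrite big_distrr; apply: eq_bigr => x _ /=.
  rewrite /gMM col_mxKu col_mxKd omegaD // omega_half_scale // dotF2_col_mx.
  by rewrite dotF2Dr !signF2D mulrC mulrACA mulrC; congr (_ * _);
    rewrite mulrC.
(* The inner sum vanishes unless p y = a; the single surviving y contributes the factor 2^m, and m
   is half of the dimension m + m. *)
rewrite (bigD1 (p^-1%g a)) //= [X in _ + X]big1 => [|y y_neq].
  rewrite permKV addr0 sum_sign_dotF2 addF2K eqxx addnn doubleK mulrC.
  rewrite /gMM_dual col_mxKu col_mxKd omegaD // omega_half_scale //.
  by rewrite [_ * omega _ _ ^+ _]mulrC.
rewrite sum_sign_dotF2 -[a]oppF2 subr_eq0; case: eqP => [pya|_];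
  last by rewrite mulr0.
by rewrite -pya permK eqxx in y_neq.
Qed.

Lemma is_dual_gbent n (f ft : 'cV['F_2]_n -> 'Z_q) : is_dual R f ft -> gbent R f.
Proof.
by move=> dual y; rewrite dual normrM !normrX omega_norm expr1n mulr1 normr_nat.
Qed.

Lemma is_dual_unique n (f ft1 ft2 : 'cV['F_2]_n -> 'Z_q) :
  is_dual R f ft1 -> is_dual R f ft2 -> ft1 =1 ft2.
Proof.
move=> dual1 dual2 y; apply: (omega_inj q_ge2 q_even) => /=.
have nz : 2 ^+ n./2 != 0 :> R[i] by rewrite expf_neq0 ?pnatr_eq0.
by apply: (mulfI nz); rewrite -dual1 -dual2.
Qed.

(** By uniqueness of the dual, [ft] can only be [gMM_dual p g]; k = 0 and k = q/2 give the two kinds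
    of self-duality. *)
Lemma gMM_dual_shift (k : 'Z_q) :
  (gbent R (gMM p g) /\
     exists ft, is_dual R (gMM p g) ft /\ forall z, gMM p g z = ft z + k) <->
  forall z, gMM p g z = gMM_dual p g z + k.
Proof.
split=> [[_ [ft [dual eqf]] z]|eqf].
  by rewrite (is_dual_unique is_dual_gMM dual).
split; [exact: is_dual_gbent is_dual_gMM |].
by exists (gMM_dual p g); split; first exact: is_dual_gMM.
Qed.

(* [c] is the sign: [0] for self-duality, [1] for anti-self-duality. *)
Lemma gMM_dual_shiftP (c : 'F_2) :
  (forall z, gMM p g z = gMM_dual p g z + half_scale q c) <->
  exists (L : 'M['F_2]_m) (b : 'cV['F_2]_m) (d : 'Z_q),
    [/\ L \in orthogonal_group m, dotF2 b b = c &
      forall y, p y = L *m (y + b) /\ g y = half_scale q (dotF2 b y) + d].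
Proof.
split=> [eqf|[L [b [d [Lorth bc pg]]]] z].
  have {}eqf x y : half_scale q (dotF2 x (p y)) + g y =
      half_scale q (dotF2 (p^-1%g x) y) + g (p^-1%g x) + half_scale q c.
    by have := eqf (col_mx x y); rewrite /gMM /gMM_dual col_mxKu col_mxKd.
  (* Both are read off [eqf] at x = 0, where d collects the terms independent of y. *)
  pose b := p^-1%g 0; pose d := g b + half_scale q c.
  have gE y : g y = half_scale q (dotF2 b y) + d.
    by have := eqf 0 y; rewrite dotF2_0l half_scale0 add0r -addrA.
  have bb : dotF2 b b = c.
    apply/eqP; rewrite -addF2_eq0; apply/eqP/(half_scale_inj q_ge2).
    apply: (addIr (g b)); rewrite half_scaleD // half_scale0 add0r [RHS]gE /d.
    by ring.
  (* Substituting the affine form of [g] cancels d, and injectivity of [half_scale] brings the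
     identity down to ['F_2]. *)
  have key x y : dotF2 x (p y) + dotF2 b y = dotF2 (p^-1%g x) y + dotF2 b (p^-1%g x) + c.
    apply: (half_scale_inj q_ge2); rewrite !half_scaleD //; apply: (addIr d).
    by have := eqf x y; rewrite !gE !addrA => ->; ring.
  (* Adding [key x 0] to [key x y] removes the terms <b, p^-1 x> + c. *)
  have adj x y : dotF2 x (p y + p 0) = dotF2 (p^-1%g x + b) y.
    have := key x 0; rewrite !dotF2_0r addr0 add0r => x0.
    apply/eqP; rewrite dotF2Dr dotF2Dl -addF2_eq0 x0.
    rewrite [X in X == _](_ : _ = (dotF2 x (p y) + dotF2 b y) +
       (dotF2 (p^-1%g x) y + dotF2 b (p^-1%g x) + c)); last by ring.
    by rewrite addF2_eq0 key.
  have [L pL pVL] := adjoint_linear adj.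
  have Lb : L *m b = p 0 by rewrite -pL permKV add0r.
  have pE y : p y = L *m (y + b).
    by rewrite mulmxDr Lb -pL -addrA addF2K addr0.
  (* Since L^T x = p^-1 x + b, the left side is p (p^-1 x). *)
  have LLT (x : 'cV['F_2]_m) : L *m (L^T *m x) = x.
    by rewrite -pVL -pE permKV.
  exists L, b, d; split=> //.
  have LLT1 : L *m L^T = 1%:M.
    apply/matrixP => i j; have /colP/(_ i) := LLT (delta_mx j 0).
    by rewrite mulmxA -colE !mxE andbT.
  by rewrite inE LLT1 eqxx andbT; have [] := mulmx1_unit LLT1.
move: Lorth; rewrite inE => /andP[_ /eqP LLT].
rewrite /gMM /gMM_dual; set x := usubmx z; set y := dsubmx z.
have -> : p^-1%g x = L^T *m x + b.
  apply: (@perm_inj _ p); rewrite permKV (pg _).1 -addrA addF2K addr0.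
  by rewrite mulmxA LLT mul1mx.
rewrite (pg y).1 !(pg _).2 addrA -half_scaleD // [RHS]addrAC addrA.
rewrite -!half_scaleD //; congr (half_scale _ _ + _).
(* After expansion the two sides differ by <b, b> + c = c + c = 0; the remaining identity is checked
   on all values of the four bits. *)
apply/eqP; rewrite dotF2_mulmx !(dotF2Dr, dotF2Dl) bc (dotF2C _ b) -addF2_eq0.
by case: (F2P (dotF2 (L^T *m x) y)) => ->; case: (F2P (dotF2 b y)) => ->;
   case: (F2P (dotF2 b (L^T *m x))) => ->; case: (F2P c) => ->.
Qed.

End MM.

(** * The two cases, with <b, b> translated into the parity of the weight *)

Theorem theorem1 (R : realType) (q m : nat) (q_ge2 : (2 <= q)%N)
    (q_even : ~~ odd q) (m_gt0 : (0 < m)%N)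
    (p : {perm 'cV['F_2]_m}) (g : 'cV['F_2]_m -> 'Z_q) :
  (self_dual_gbent R (gMM p g) <->
     exists (L : 'M['F_2]_m) (b : 'cV['F_2]_m) (d : 'Z_q),
       [/\ L \in orthogonal_group m, ~~ odd (wt b) &
           forall y : 'cV['F_2]_m,
             p y = L *m (y + b) /\ g y = half_scale q (dotF2 b y) + d]) /\
  (anti_self_dual_gbent R (gMM p g) <->
     exists (L : 'M['F_2]_m) (b : 'cV['F_2]_m) (d : 'Z_q),
       [/\ L \in orthogonal_group m, odd (wt b) &
           forall y : 'cV['F_2]_m,
             p y = L *m (y + b) /\ g y = half_scale q (dotF2 b y) + d]).
Proof.
have wt_even (b : 'cV['F_2]_m) : ~~ odd (wt b) <-> dotF2 b b = 0.
  by rewrite odd_wt; case: (F2P (dotF2 b b)) => ->.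
have wt_odd (b : 'cV['F_2]_m) : odd (wt b) <-> dotF2 b b = 1.
  by rewrite odd_wt; split=> /eqP.
split; split.
- case=> bent [ft [dual eqf]].
  have [|L [b [d [? /wt_even ? ?]]]] := (gMM_dual_shiftP q_ge2 q_even p g 0).1.
    apply/(gMM_dual_shift R q_ge2 q_even); split=> //; exists ft; split=> // z.
    by rewrite half_scale0 addr0.
  by exists L, b, d.
- case=> L [b [d [? /wt_even ? ?]]].
  have [] := (gMM_dual_shift R q_ge2 q_even p g _).2
    ((gMM_dual_shiftP q_ge2 q_even p g 0).2 _); first by exists L, b, d.
  move=> bent [ft [dual eqf]]; split=> //; exists ft; split=> // z.
  by rewrite eqf half_scale0 addr0.
- case=> bent [ft [dual eqf]].
  have [|L [b [d [? /wt_odd ? ?]]]] := (gMM_dual_shiftP q_ge2 q_even p g 1).1.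
    apply/(gMM_dual_shift R q_ge2 q_even); split=> //; exists ft; split=> // z.
    by rewrite half_scale1.
  by exists L, b, d.
case=> L [b [d [? /wt_odd ? ?]]].
have [] := (gMM_dual_shift R q_ge2 q_even p g _).2
  ((gMM_dual_shiftP q_ge2 q_even p g 1).2 _); first by exists L, b, d.
move=> bent [ft [dual eqf]]; split=> //; exists ft; split=> // z.
by rewrite eqf half_scale1.
Qed.
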